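(* Let $f:\mathbb{R}^m\to(-\infty,\infty]$ be proper, lower semicontinuous and bounded from below. For some $\eta>0$, let $\xi:[0,\eta)\to\mathbb{R}_+$ be a nondecreasing continuous function with $\xi(0)=0$, and let $\{s_k\}$ be a nonnegative sequence with $\lim_{k\to\infty}s_k=0$. Let $\{(x_k,e_k)\}\subset\mathbb{R}^m\times\mathbb{R}_+$ be a sequence satisfying conditions (H0), (H1), (H2), (H3) listed in the context, and assume that the set $\mathcal{L}(f(x_{k_0}))=\{y\in\mathbb{R}^m: f(y)\le f(x_{k_0})\}$ is bounded for some $k_0\in\mathbb{N}$. Let $\Omega$ be the set of accumulation points of $\{x_k\}$ and let $\Gamma=\{x: 0\in\partial f(x)\}$. Take any point $\overline{x}$ and any closed set $\Xi$ with $\overline{x}\in\Omega\subset\Xi\subset\Gamma$, and a nondecreasing function $\tau:\mathbb{R}_+\to\mathbb{R}_+$ that is asymptotically shrinking around zero. Suppose that there exist $\ell_1\in[0,1)$, $\ell_2,\ell_3\in[0,\infty)$ and $k_1\in\mathbb{N}\setminus\{0\}$ such that for every $k\ge k_1$ with $\|x_k-\overline{x}\|<\eta$ the following two inequalities hold: (i) $s_k\le\tau(s_{k-1})$; (ii) $e_k\le\ell_1e_{k-1}+\ell_2\Lambda_{k,k+1}+\ell_3s_k$, where $\Lambda_{k,k+1}:=\xi(f(x_k)-f(\overline{x}))-\xi(f(x_{k+1})-f(\overline{x}))$ (the arguments of $\xi$ being in its domain $[0,\eta)$). Then there exists $k_2\in\mathbb{N}$ with $k_2\ge k_1$ such that $\|x_k-\overline{x}\|<\eta$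 for all $k>k_2$, and therefore the inequalities in (i) and (ii) hold for all $k>k_2$. Moreover, $$\sum_{k=0}^\infty e_k<\infty,\qquad \sum_{k=1}^\infty\|x_{k+1}-x_k\|<\infty,$$ and the sequence $\{x_k\}$ converges to $\overline{x}\in\Xi$ as $k\to\infty$.
   Context: $\mathbb{R}_+=[0,\infty)$, $\mathbb{N}=\{0,1,\ldots\}$. The (limiting, Mordukhovich) subdifferential $\partial f(\overline x)$ at $\overline x\in\mathrm{dom} f$ is the set of $v\in\mathbb{R}^m$ for which there exist $x_k\to\overline x$ with $f(x_k)\to f(\overline x)$ and $v_k\to v$ such that $\liminf_{x\to x_k}\frac{f(x)-f(x_k)-\langle v_k,x-x_k\rangle}{\|x-x_k\|}\ge0$ for all $k$; $\partial f(x)=\emptyset$ if $f(x)=\infty$. A function $\beta:\mathbb{R}_+\to\mathbb{R}_+$ is admissible if $\beta(0)=0$ and $\beta(t)\to0$ implies $t\to0$. Conditions on $\{(x_k,e_k)\}$: (H0) $f(x_{k+1})\le f(x_k)$ for all $k\in\mathbb{N}$. (H1) There exists $c>0$ such that $\|x_{k+1}-x_k\|\le c\,e_k$ for all $k\in\mathbb{N}$, and $\lim_{k\to\infty}e_k=0$. (H2) For all $k\in\mathbb{N}$ there exists $w_{k+1}\in\partial f(x_{k+1})$ such that $\|w_{k+1}\|\le b\,\beta(e_k)$, where $b>0$ is a fixed constant and $\beta$ is an admissible function. (H3) For each subsequence $\{x_{k_j}\}$ with $\lim_{j\to\infty}x_{k_j}=\widetilde x$, one has $\limsup_{j\to\infty}f(x_{k_j})\le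 f(\widetilde x)$. A function $\tau:\mathbb{R}_+\to\mathbb{R}_+$ is asymptotically shrinking around zero if $\tau(0)=0$ and $\limsup_{t\to0^+}\sum_{n=0}^\infty\frac{\tau^n(t)}{t}<\infty$, where $\tau^0(t):=t$ and $\tau^n(t):=\tau(\tau^{n-1}(t))$ for $n\ge1$. *)

(* Defs.v *)
From mathcomp Require Import all_boot all_order all_algebra.
From mathcomp Require Import all_classical all_reals all_analysis.
Import Order.TTheory GRing.Theory Num.Theory.
Import numFieldNormedType.Exports.
Set Implicit Arguments.
Unset Strict Implicit.
Unset Printing Implicit Defensive.
Local Open Scope classical_set_scope.
Local Open Scope ring_scope.

(* The library norm on 'rV[R]_m is the sup norm, so the Euclidean structure is
   defined here.  Both norms induce the same topology and the same bounded sets,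
   hence limits, closed sets, cluster points and bounded_set are the library's. *)
Definition dotv (R : realType) (m : nat) (u v : 'rV[R]_m) : R :=
  \sum_(i < m) u ord0 i * v ord0 i.

Definition enorm (R : realType) (m : nat) (u : 'rV[R]_m) : R :=
  Num.sqrt (dotv u u).

Section subdifferential.
Variables (R : realType) (m : nat).
Implicit Types (f : 'rV[R]_m -> \bar R) (x v : 'rV[R]_m).

Definition proper_fun f : Prop :=
  (forall x, f x != -oo%E) /\ (exists x, (f x < +oo)%E).

Definition bounded_below f : Prop := exists M : R, forall x, (M%:E <= f x)%E.

Definition diff_quotient f x v (y : 'rV[R]_m) : \bar R :=
  ((f y - f x - (dotv v (y - x))%:E) / (enorm (y - x))%:E)%E.

(* The difference quotient is meaningful only at points where f is finite. *)
Definition regular_subgradient f x v : Prop :=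
  f x \is a fin_num /\ (0 <= limf_einf (diff_quotient f x v) x^')%E.

Definition subdiff f x : set 'rV[R]_m := [set v |
  f x \is a fin_num /\
  exists (u w : nat -> 'rV[R]_m),
    [/\ u @ \oo --> x,
        (f \o u) @ \oo --> f x,
        w @ \oo --> v &
        forall k, regular_subgradient f (u k) (w k)]].

End subdifferential.

(* Functions R_+ -> R_+ (and [0, eta[ -> R_+) are total functions R -> R, all of
   whose hypotheses are restricted to the intended domain. *)
Section real_functions.
Variable R : realType.
Implicit Types beta tau xi : R -> R.

Definition maps_nonneg beta : Prop := forall t, 0 <= t -> 0 <= beta t.

Definition nondecreasing_on_nonneg tau : Prop :=
  forall s t, 0 <= s -> s <= t -> tau s <= tau t.

Definition admissible beta : Prop :=
  [/\ maps_nonneg beta, beta 0 = 0 &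
      forall t : nat -> R, (forall n, 0 <= t n) ->
        (beta \o t) @ \oo --> (0 : R) -> t @ \oo --> (0 : R)].

Definition asymptotically_shrinking tau : Prop :=
  [/\ maps_nonneg tau, tau 0 = 0 &
      (limf_esup (fun t : R => \sum_(0 <= n <oo) (iter n tau t / t)%:E)
                 (0 : R)^'+ < +oo)%E].

Definition modulus (eta : R) xi : Prop :=
  [/\ forall t, 0 <= t < eta -> 0 <= xi t,
      forall s t, 0 <= s -> s <= t -> t < eta -> xi s <= xi t,
      {within `[0, eta[, continuous xi} &
      xi 0 = 0].

End real_functions.

Section conditions.
Variables (R : realType) (m : nat) (f : 'rV[R]_m -> \bar R).
Variables (x : nat -> 'rV[R]_m) (e : nat -> R).

Definition condH0 : Prop := forall k, (f (x k.+1) <= f (x k))%E.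

Definition condH1 : Prop :=
  (exists2 c : R, 0 < c & forall k, enorm (x k.+1 - x k) <= c * e k) /\
  e @ \oo --> (0 : R).

Definition condH2 : Prop :=
  exists (b : R) (beta : R -> R), [/\ 0 < b, admissible beta &
    forall k, exists2 w, subdiff f (x k.+1) w & enorm w <= b * beta (e k)].

Definition condH3 : Prop :=
  forall (k : nat -> nat) (xt : 'rV[R]_m),
    {homo k : i j / (i < j)%N} ->
    (x \o k) @ \oo --> xt ->
    (limn_esup (f \o x \o k) <= f xt)%E.

End conditions.

Section inequalities.
Variables (R : realType) (m : nat) (f : 'rV[R]_m -> \bar R).
Variables (eta : R) (xi : R -> R) (xbar : 'rV[R]_m).
Variables (x : nat -> 'rV[R]_m) (e s : nat -> R).

Definition in_xi_dom (y : 'rV[R]_m) : Prop :=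
  (0 <= f y - f xbar)%E /\ (f y - f xbar < eta%:E)%E.

Definition Lambda (k l : nat) : R :=
  xi (fine (f (x k) - f xbar)%E) - xi (fine (f (x l) - f xbar)%E).

(* Used only for k >= 1, so that k.-1 is the genuine predecessor. *)
Definition ineq_i (tau : R -> R) (k : nat) : Prop := s k <= tau (s k.-1).

(* That both arguments of xi lie in [0, eta[ is part of the inequality, which
   would otherwise be undefined. *)
Definition ineq_ii (l1 l2 l3 : R) (k : nat) : Prop :=
  [/\ in_xi_dom (x k), in_xi_dom (x k.+1) &
      e k <= l1 * e k.-1 + l2 * Lambda k k.+1 + l3 * s k].

End inequalities.

(* Main.v *)
Require Import Defs.
From mathcomp Require Import all_boot all_order all_algebra.
From mathcomp Require Import all_classical all_reals all_analysis.
From mathcomp Require Import ring lra.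
Import Order.TTheory GRing.Theory Num.Theory.
Import numFieldNormedType.Exports.
Local Open Scope classical_set_scope.
Local Open Scope ring_scope.

(** The inequality in [ineq_ii] is a perturbed contraction for the steps [e k].  Summed
    over a run of consecutive indices it telescopes: the terms [l1 * e k.-1]
    are absorbed on the left because [l1 < 1], the terms [Lambda] collapse to
    the first value of [xi (f (x k) - f xbar)], and the errors [s k] are
    dominated by the [tau]-orbit of their first term, whose sum is at most a
    constant times that term.  Hence the sum of the [e k] over the run is at
    most a multiple of the data at its start
    ([sum_recursion_le], [iterate_dominates],
    [asymptotically_shrinking_orbit_sum]).

    The inequality is only available while the iterates stay near [xbar], and
    the estimate is what keeps them there: the distance to [xbar] grows by at
    most [c] times the sum of the [e k], so if the run starts close enough to
    [xbar] with small data, the iterates can never leave the ball, and the run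
    is infinite ([trapping]).

    Such starting indices exist ([tail_trapped]): the iterates come back close
    to [xbar] infinitely often, [e] and [s] tend to 0, and [f (x k)] eventually
    drops below any number above [f xbar], by [condH3] along a subsequence
    converging to [xbar] and by the monotonicity [condH0] for all later indices;
    [xi] is continuous at 0 with value 0.  Conversely [f xbar <= f (x k)]
    whenever [x k] is near [xbar], because the arguments of [xi] in [ineq_ii] lie in
    its domain.  Trapping in the ball of radius [eta] gives the inequalities
    for all large indices and the two summability claims; trapping in
    arbitrarily small balls gives convergence. *)

(** * Euclidean norm *)

Section euclid.
Context {R : realType} {m : nat}.
Implicit Types u v w : 'rV[R]_m.

Lemma dotvC u v : dotv u v = dotv v u.
Proof. by apply: eq_bigr => i _; rewrite mulrC. Qed.

Lemma dotvDl u v w : dotv (u + v) w = dotv u w + dotv v w.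
Proof. by rewrite /dotv -big_split; apply: eq_bigr => i _; rewrite mxE mulrDl. Qed.

Lemma dotvZl a u v : dotv (a *: u) v = a * dotv u v.
Proof. by rewrite /dotv mulr_sumr; apply: eq_bigr => i _; rewrite mxE mulrA. Qed.

Lemma dotv_ge0 u : 0 <= dotv u u.
Proof. by apply: sumr_ge0 => i _; rewrite -expr2 sqr_ge0. Qed.

Lemma enorm_ge0 u : 0 <= enorm u.
Proof. exact: sqrtr_ge0. Qed.

Lemma enorm_sqr u : enorm u ^+ 2 = dotv u u.
Proof. by rewrite sqr_sqrtr // dotv_ge0. Qed.

Lemma ler_coord_enorm u i : `|u ord0 i| <= enorm u.
Proof.
rewrite -sqrtr_sqr ler_sqrt; last exact: dotv_ge0.
rewrite /dotv (bigD1 i) //= -expr2 lerDl.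
by apply: sumr_ge0 => j _; rewrite -expr2 sqr_ge0.
Qed.

Lemma ler_norm_enorm u : `|u| <= enorm u.
Proof.
rewrite /Num.norm /= mx_normrE.
apply: bigmax_le; first exact: enorm_ge0.
by move=> -[i j] _ /=; rewrite (ord1 i) ler_coord_enorm.
Qed.

Lemma ler_enorm_norm u : enorm u <= Num.sqrt m%:R * `|u|.
Proof.
rewrite -[`|u|]ger0_norm // -sqrtr_sqr -sqrtrM ?ler0n //.
rewrite ler_sqrt; last by rewrite mulr_ge0 ?ler0n ?sqr_ge0.
have -> : m%:R * `|u| ^+ 2 = \sum_(i < m) `|u| ^+ 2.
  by rewrite sumr_const card_ord mulr_natl.
apply: ler_sum => i _; rewrite -expr2 -real_normK ?num_real //.
rewrite ler_pXn2r ?nnegrE //.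
by rewrite {2}/Num.norm /= mx_normrE (le_bigmax _ (fun ij => `|u ij.1 ij.2|) (ord0, i)).
Qed.

(** Cauchy-Schwarz, from the nonnegativity of the square of
    [enorm v *: u - enorm u *: v]; dividing by [enorm u * enorm v] at the end
    is why vanishing norms are treated apart. *)
Lemma dotv_le_enorm u v : dotv u v <= enorm u * enorm v.
Proof.
set a := enorm u; set b := enorm v.
have [b0|b_neq0] := eqVneq b 0.
  suff -> : v = 0 by rewrite dotvC -(scale0r u) dotvZl mul0r mulr_ge0 ?enorm_ge0.
  by apply/eqP; rewrite -normr_le0 -b0 ler_norm_enorm.
have [a0|a_neq0] := eqVneq a 0.
  suff -> : u = 0 by rewrite -(scale0r v) dotvZl mul0r mulr_ge0 ?enorm_ge0.
  by apply/eqP; rewrite -normr_le0 -a0 ler_norm_enorm.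
have a_gt0 : 0 < a by rewrite lt_neqAle eq_sym a_neq0 enorm_ge0.
have b_gt0 : 0 < b by rewrite lt_neqAle eq_sym b_neq0 enorm_ge0.
have := dotv_ge0 (b *: u + (- a) *: v).
rewrite !(dotvDl, dotvZl) !(dotvC _ (_ + _)) !(dotvDl, dotvZl) (dotvC v u) -!enorm_sqr -/a -/b.
have -> : b * (b * a ^+ 2 + - a * dotv u v) + - a * (b * dotv u v + - a * b ^+ 2)
  = (2 * (a * b)) * (a * b - dotv u v) by ring.
by rewrite pmulr_rge0 ?subr_ge0 // !mulr_gt0.
Qed.

Lemma ler_enormD u v : enorm (u + v) <= enorm u + enorm v.
Proof.
rewrite -(@ler_pXn2r _ 2) ?nnegrE ?addr_ge0 ?enorm_ge0 // enorm_sqr.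
rewrite dotvDl !(dotvC _ (_ + _)) !dotvDl (dotvC v u) sqrrD !enorm_sqr.
by have := dotv_le_enorm u v; lra.
Qed.
End euclid.

(** * Cluster points of sequences *)

Lemma cluster_subseq {R : realType} (T : pseudoMetricType R) (u : nat -> T) (a : T) :
  cluster (u @ \oo) a ->
  exists2 k : nat -> nat, {homo k : i j / (i < j)%N} & (u \o k) @ \oo --> a.
Proof.
move=> ua.
have near_a (N j : nat) : exists n, (N <= n)%N /\ ball a j.+1%:R^-1 (u n).
  have [_ [[n Nn <-] ?]] : [set u n | n in [set n | (N <= n)%N]] `&` ball a (j.+1%:R^-1) !=set0.
    apply: ua; last by apply: nbhsx_ballx; rewrite invr_gt0.
    by exists N => // n Nn; exists n.
  by exists n.
have /choice [g gP] : forall Nj : nat * nat, exists n, (Nj.1 <= n)%N /\ ball a Nj.2.+1%:R^-1 (u n).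
  by move=> [N j]; exact: near_a.
(* Each index is chosen beyond the previous one, in a ball of radius 1/(j+1). *)
pose k := fix k j := if j is j'.+1 then g ((k j').+1, j) else g (0%N, 0%N).
exists k.
  by apply: homo_ltn => [|j]; [exact: ltn_trans | exact: (gP ((k j).+1, j.+1)).1].
apply/cvg_ballP => eps eps_gt0; near=> j.
have jP i : ball a i.+1%:R^-1 (u (k i)).
  by case: i => [|i]; [exact: (gP (0%N, 0%N)).2 | exact: (gP ((k i).+1, i.+1)).2].
apply: le_ball (jP j); near: j.
have := @near_infty_natSinv_lt R (PosNum eps_gt0).
by apply: filterS => j /ltW.
Unshelve. all: end_near. Qed.

(** * Orbits of shrinking functions and summed recursions *)

Section shrink.
Context {R : realType}.

(** A finite upper limit of [sum_n tau^n(t) / t] at 0 is a uniform bound of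
    this quotient on some interval ]0, delta[; multiplying by [t] turns it into
    a linear bound, which also covers [t = 0]. *)
Lemma asymptotically_shrinking_orbit_sum (tau : R -> R) : asymptotically_shrinking tau ->
  exists C delta : R, [/\ 0 <= C, 0 < delta &
    forall t n, 0 <= t -> t < delta -> \sum_(i < n) iter i tau t <= C * t].
Proof.
move=> [tau_ge0 tau0 /ereal_inf_lt[_ [V V0 <-] supV]].
have [d /= d_gt0 dV] : \forall d \near 0^'+, V d by [].
pose S t : \bar R := (\sum_(0 <= n <oo) (iter n tau t / t)%:E)%E.
have iter_ge0 t i : 0 <= t -> 0 <= iter i tau t.
  by move=> t0; elim: i => //= i; exact: tau_ge0.
(* The absolute value only makes the constant visibly nonnegative. *)
exists (`|fine (ereal_sup [set S t | t in V])|), d; split=> // t n t_ge0 t_lt.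
have [->|t_neq0] := eqVneq t 0.
  rewrite mulr0 big1 // => i _; elim: (nat_of_ord i) => //= j ->; exact: tau0.
have t_gt0 : 0 < t by rewrite lt_neqAle eq_sym t_neq0.
have St_le : (S t <= ereal_sup [set S t | t in V])%E.
  apply: ereal_sup_ubound; exists t => //; apply: dV => //.
  by rewrite /ball_ /= sub0r normrN gtr0_norm.
have partial_le : ((\sum_(i < n) iter i tau t / t)%:E <= S t)%E.
  rewrite -sumEFin -(big_mkord xpredT (fun i => (iter i tau t / t)%:E)).
  by apply: nneseries_lim_ge => i _; rewrite lee_fin divr_ge0 ?iter_ge0.
have : ((\sum_(i < n) iter i tau t / t)%:E <= ereal_sup [set S t | t in V])%E
  by exact: le_trans partial_le St_le.
have sup_fin : ereal_sup [set S t | t in V] \is a fin_num.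
  rewrite fin_numElt supV andbT; apply: lt_le_trans (le_trans partial_le St_le).
  exact: ltNyr.
rewrite -(fineK sup_fin) lee_fin -mulr_suml ler_pdivrMr // => /le_trans; apply.
by rewrite ler_wpM2r // ler_norm.
Qed.
End shrink.

Lemma iterate_dominates {R : realType} (tau : R -> R) (s : nat -> R) n :
  nondecreasing_on_nonneg tau -> (forall k, 0 <= s k) ->
  (forall k, (k < n)%N -> s k.+1 <= tau (s k)) ->
  forall k, (k <= n)%N -> s k <= iter k tau (s 0%N).
Proof.
move=> tau_nd s_ge0 s_le; elim=> [//|k IH] kn /=.
by rewrite (le_trans (s_le k kn)) // tau_nd // IH // ltnW.
Qed.

(** The extra term [l1 * e n] on the left is what makes the induction close:
    with it, each step of the recursion is added without any loss. *)
Lemma sum_recursion_le {R : realFieldType} (l1 l2 l3 : R) (e phi s : nat -> R) n :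
  (forall k, (k < n)%N ->
     e k.+1 <= l1 * e k + l2 * (phi k.+1 - phi k.+2) + l3 * s k.+1) ->
  (1 - l1) * (\sum_(k < n) e k.+1) + l1 * e n <=
  l1 * e 0%N + l2 * (phi 1%N - phi n.+1) + l3 * \sum_(k < n) s k.+1.
Proof.
elim: n => [|n IH] step; first by rewrite !big_ord0 subrr !mulr0 !addr0 add0r.
rewrite !big_ord_recr /=.
have := IH (fun k kn => step k (ltnW kn)); have := step n (ltnSn n).
set A := \sum_(_ < n) _; set B := \sum_(_ < n) _; nra.
Qed.

(** Here [d] plays the distance to the limit, controlled by the path length,
    and the recursion holds only as long as [d] is below [eps].  The argument
    is a bootstrap: as long as the first [n] distances are below [eps], the
    recursion bounds the path travelled so far by the data at the start, and
    the smallness assumption on these data puts the next distance below [eps]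
    too. *)
Lemma trapping {R : realType} (tau : R -> R) (l1 l2 l3 c C eps delta : R)
    (d e phi s : nat -> R) :
  nondecreasing_on_nonneg tau ->
  (forall t n, 0 <= t -> t < delta -> \sum_(i < n) iter i tau t <= C * t) ->
  0 <= l1 -> l1 < 1 -> 0 <= l2 -> 0 <= l3 -> 0 <= c ->
  (forall k, 0 <= e k) -> (forall k, 0 <= s k) ->
  (forall n, d n.+1 <= d 1%N + c * \sum_(k < n) e k.+1) ->
  (forall k, d k.+1 < eps ->
     [/\ s k.+1 <= tau (s k), 0 <= phi k.+2 &
         e k.+1 <= l1 * e k + l2 * (phi k.+1 - phi k.+2) + l3 * s k.+1]) ->
  s 0%N < delta -> 0 <= phi 1%N ->
  d 1%N + c * ((l1 * e 0%N + l2 * phi 1%N + l3 * (C * s 0%N)) / (1 - l1)) < eps ->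
  forall n, d n.+1 < eps /\
    \sum_(k < n) e k.+1 <=
      (l1 * e 0%N + l2 * phi 1%N + l3 * (C * s 0%N)) / (1 - l1).
Proof.
move=> tau_nd orbit_le l1_ge0 l1_lt1 l2_ge0 l3_ge0 c_ge0 e_ge0 s_ge0 d_le step s0_lt phi1_ge0.
set B := _ / _ => small.
suff bound n : (forall k, (k < n)%N -> d k.+1 < eps) -> \sum_(k < n) e k.+1 <= B.
  have d_lt n : d n.+1 < eps.
    elim/ltn_ind: n => n IH; apply: le_lt_trans small.
    by rewrite (le_trans (d_le n)) // lerD2l ler_wpM2l // bound.
  by move=> n; split; [exact: d_lt | exact: bound (fun k _ => d_lt k)].
move=> inball.
have stepn k (kn : (k < n)%N) := step k (inball k kn).
have phi_ge0 : 0 <= phi n.+1.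
  by case: n stepn {inball} => // n stepn; have [] := stepn n (ltnSn n).
have := @sum_recursion_le _ l1 l2 l3 e phi s n
  (fun k kn => let: And3 _ _ ek := stepn k kn in ek).
have s_sum : \sum_(k < n) s k.+1 <= C * s 0%N.
  apply: le_trans (orbit_le (s 0%N) n.+1 (s_ge0 _) s0_lt).
  rewrite big_ord_recl /= -[leLHS]add0r lerD // ler_sum // => i _.
  apply: (@iterate_dominates _ tau s n) => // k kn.
  by have [] := stepn k kn.
have l1e := mulr_ge0 l1_ge0 (e_ge0 n).
have l2p := mulr_ge0 l2_ge0 phi_ge0.
have l3s := ler_wpM2l l3_ge0 s_sum.
rewrite ler_pdivlMr ?subr_gt0 // mulrC mulrBr; lra.
Qed.

(** * Series and moduli *)

Lemma nneseries_lty {R : realType} (u : nat -> R) (N : nat) (M : R) :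
  (forall k, 0 <= u k) -> (forall n, \sum_(k < n) u (N + k)%N <= M) ->
  (\sum_(N <= k <oo) (u k)%:E < +oo)%E.
Proof.
move=> u_ge0 u_le.
apply: (@le_lt_trans _ _ M%:E); last exact: ltry.
have -> : (\sum_(N <= k <oo) (u k)%:E = \sum_(0 <= k <oo) (u (k + N)%N)%:E)%E.
  by rewrite (nneseries_addn (f := fun k => (u k)%:E)) // => i; rewrite lee_fin.
apply: lime_le.
  by apply: is_cvg_nneseries => n _ _; rewrite lee_fin.
near=> n; rewrite sumEFin lee_fin big_mkord.
by under eq_bigr do rewrite addnC.
Unshelve. all: end_near. Qed.

Lemma modulus_near0 {R : realType} (eta : R) (xi : R -> R) (eps : R) :
  0 < eta -> modulus eta xi -> 0 < eps ->
  exists2 delta, 0 < delta &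
    forall t, 0 <= t -> t < eta -> t < delta -> xi t < eps.
Proof.
move=> eta_gt0 [_ _ xi_cont xi0] eps_gt0.
have dom0 : `[0, eta[%classic (0 : R) by rewrite /= in_itv /= lexx.
have [delta /= delta_gt0 H] :
    within `[0, eta[ (nbhs (0 : R)) [set t | `|xi 0 - xi t| < eps].
  by rewrite nbhs_subspace_in //; have /cvgrPdist_lt := xi_cont 0; apply.
exists delta => // t t_ge0 t_eta t_delta.
have := H t; rewrite /= in_itv /= t_ge0 t_eta sub0r normrN ger0_norm // => /(_ t_delta isT).
by rewrite xi0 sub0r normrN; exact/le_lt_trans/ler_norm.
Qed.

(** * Behaviour of the iterates near the cluster point *)

(** [condH3] puts a single iterate of a subsequence converging to [xbar] below
    [r]; [condH0] carries this to all later iterates. *)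
Lemma eventually_value_lt {R : realType} {m : nat} (f : 'rV[R]_m -> \bar R)
    (x : nat -> 'rV[R]_m) (xbar : 'rV[R]_m) (r : R) :
  condH0 f x -> condH3 f x -> cluster (x @ \oo) xbar -> (f xbar < r%:E)%E ->
  exists N, forall k, (N <= k)%N -> (f (x k) < r%:E)%E.
Proof.
move=> H0 H3 /cluster_subseq[k k_incr xk] fr.
have /ereal_inf_lt[_ [V [N _ NV] <-]] := le_lt_trans (H3 k xbar k_incr xk) fr.
move=> sup_lt; exists (k N) => n kn.
have f_anti i j : (i <= j)%N -> (f (x j) <= f (x i))%E.
  by move=> ij; rewrite -(subnK ij); elim: (j - i)%N => // h; apply/le_trans/H0.
apply: le_lt_trans sup_lt; apply: le_trans (f_anti _ _ kn) _.
by apply: ereal_sup_ubound; exists N => //; apply: NV => /=.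
Qed.

(** The topology of row vectors comes from the sup norm, so Euclidean
    closeness is obtained from sup-norm closeness with a smaller radius. *)
Lemma enorm_lt_of_norm {R : realType} {m : nat} (eps : R) : 0 < eps ->
  exists2 r : R, 0 < r & forall u : 'rV[R]_m, `|u| < r -> enorm u < eps.
Proof.
move=> eps_gt0; have sqrtm1_gt0 : 0 < Num.sqrt m%:R + 1 :> R.
  by rewrite ltr_wpDl // sqrtr_ge0.
(* The summand 1 keeps the denominator positive in dimension 0. *)
exists (eps / (Num.sqrt m%:R + 1)); first exact: divr_gt0.
move=> u; rewrite ltr_pdivlMr // => u_lt.
apply: le_lt_trans (ler_enorm_norm u) _; apply: le_lt_trans u_lt.
by rewrite mulrC ler_wpM2l // lerDl.
Qed.

Lemma cluster_enorm {R : realType} {m : nat} (x : nat -> 'rV[R]_m) (xbar : 'rV[R]_m) :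
  cluster (x @ \oo) xbar ->
  forall (eps : R) N, 0 < eps -> exists2 n, (N <= n)%N & enorm (x n - xbar) < eps.
Proof.
move=> /cluster_subseq[k k_incr xk] eps N /(enorm_lt_of_norm (m := m))[r r_gt0 rP].
have /cvgrPdist_lt/(_ r r_gt0)[n0 _ near_xbar] := xk.
have k_ge i : (i <= k i)%N.
  by elim: i => // i IH; exact: leq_ltn_trans IH (k_incr _ _ (ltnSn i)).
exists (k (maxn n0 N)); first by rewrite (leq_trans _ (k_ge _)) // leq_maxr.
apply: rP; rewrite distrC; apply: near_xbar; exact: leq_maxl.
Qed.

Lemma path_length_le {R : realType} {m : nat} (x : nat -> 'rV[R]_m) (e : nat -> R)
    (xbar : 'rV[R]_m) (c : R) (K n : nat) :
  (forall k, enorm (x k.+1 - x k) <= c * e k) ->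
  enorm (x (n + K)%N - xbar) <= enorm (x K - xbar) + c * \sum_(k < n) e (k + K)%N.
Proof.
move=> step; elim: n => [|n IH]; first by rewrite big_ord0 mulr0 addr0.
rewrite big_ord_recr /= mulrDr addrA addrC.
have -> : x (n.+1 + K)%N - xbar = (x (n + K).+1 - x (n + K)%N) + (x (n + K)%N - xbar).
  by rewrite addrA subrK.
by rewrite (le_trans (ler_enormD _ _)) // lerD.
Qed.

Lemma cvg_enorm {R : realType} {m : nat} (x : nat -> 'rV[R]_m) (xbar : 'rV[R]_m) :
  (forall eps : R, 0 < eps ->
     exists N, forall n, (N <= n)%N -> enorm (x n - xbar) < eps) ->
  x @ \oo --> xbar.
Proof.
move=> small; apply/cvgrPdist_lt => eps /small[N NP]; exists N => // n Nn /=.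
by rewrite distrC; exact: le_lt_trans (ler_norm_enorm _) (NP n Nn).
Qed.

(** Iterates return close to [xbar] at arbitrarily late times, when [e], [s]
    and [f (x k) - f xbar] are already as small as desired; from such a time on
    [trapping] applies to the shifted sequences. *)
Lemma tail_trapped {R : realType} {m : nat} (f : 'rV[R]_m -> \bar R)
    (eta : R) (xi : R -> R) (x : nat -> 'rV[R]_m) (e s : nat -> R)
    (xbar : 'rV[R]_m) (tau : R -> R) (l1 l2 l3 c : R) (k1 : nat) :
  0 < eta -> modulus eta xi ->
  (forall k, 0 <= s k) -> s @ \oo --> (0 : R) ->
  (forall k, 0 <= e k) -> e @ \oo --> (0 : R) ->
  condH0 f x -> condH3 f x ->
  0 < c -> (forall k, enorm (x k.+1 - x k) <= c * e k) ->
  cluster (x @ \oo) xbar -> f xbar \is a fin_num ->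
  (forall k, f (x k.+1) \is a fin_num) ->
  nondecreasing_on_nonneg tau -> asymptotically_shrinking tau ->
  0 <= l1 -> l1 < 1 -> 0 <= l2 -> 0 <= l3 ->
  (forall k, (k1 <= k)%N -> enorm (x k - xbar) < eta ->
     ineq_i s tau k /\ ineq_ii f eta xi xbar x e s l1 l2 l3 k) ->
  forall eps, 0 < eps -> eps <= eta ->
  exists K M, (k1 <= K)%N /\
    forall n, enorm (x (n.+1 + K)%N - xbar) < eps /\
              \sum_(k < n) e (k.+1 + K)%N <= M.
Proof.
move=> eta_gt0 xi_mod s_ge0 s0 e_ge0 e0 H0 H3 c_gt0 step acc fbar_fin fx_fin.
move=> tau_nd /asymptotically_shrinking_orbit_sum[C [delta [C_ge0 delta_gt0 orbit_le]]].
move=> l1_ge0 l1_lt1 l2_ge0 l3_ge0 Hineq eps eps_gt0 eps_le.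
(* If all data at the start are below gamma, the path length is below
   c * A * gamma; gamma is chosen so that gamma + c * A * gamma = eps. *)
pose A := (l1 + l2 + l3 * C) / (1 - l1).
have A_ge0 : 0 <= A by apply: divr_ge0; [rewrite !addr_ge0 ?mulr_ge0 | rewrite subr_ge0 ltW].
have Q_gt0 : 0 < 1 + c * A by rewrite ltr_pwDl // mulr_ge0 // ltW.
pose gamma := eps / (1 + c * A).
have gamma_gt0 : 0 < gamma by exact: divr_gt0.
have [dxi dxi_gt0 dxiP] := modulus_near0 eta xi gamma eta_gt0 xi_mod gamma_gt0.
have [N1 N1P] : exists N, forall k, (N <= k)%N -> (f (x k) < (fine (f xbar) + dxi)%:E)%E.
  apply: eventually_value_lt H0 H3 acc _.
  by rewrite -{1}(fineK fbar_fin) lte_fin ltrDl.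
have /cvgrPdist_lt/(_ _ gamma_gt0)[N2 _ N2P] := e0.
have min_gt0 : 0 < Num.min gamma delta by rewrite lt_min gamma_gt0.
have /cvgrPdist_lt/(_ _ min_gt0)[N3 _ N3P] := s0.
pose N := maxn k1 (maxn N1 (maxn N2 N3)).
have min2_gt0 : 0 < Num.min gamma eta by rewrite lt_min gamma_gt0.
(* The run starts at K.+1, so that the recursion can refer to e K and s K. *)
have [[//|K] NK] := cluster_enorm x xbar acc _ N.+1 min2_gt0.
rewrite lt_min => /andP[dK_gamma dK_eta].
rewrite ltnS !geq_max in NK; have /and4P[k1K N1K N2K N3K] := NK.
have eK : e K < gamma.
  by have := N2P K N2K; rewrite /= sub0r normrN ger0_norm.
have [sK_gamma sK_delta] : s K < gamma /\ s K < delta.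
  by apply/andP; have := N3P K N3K; rewrite /= sub0r normrN ger0_norm // lt_min.
pose phi k := xi (fine (f (x (k + K)%N) - f xbar)%E).
have xi_ge0 k : in_xi_dom f eta xbar (x k.+1) -> 0 <= xi (fine (f (x k.+1) - f xbar)%E).
  move=> []; rewrite -(fineK (fx_fin k)) -(fineK fbar_fin) -EFinB lee_fin lte_fin /= => ge0 lt.
  by have [xi_ge0 _ _ _] := xi_mod; rewrite xi_ge0 // ge0.
have [_ [dom1 dom2 _]] := Hineq K.+1 (leqW k1K) dK_eta.
have phi1_ge0 : 0 <= phi 1%N by exact: xi_ge0.
have phi1_lt : phi 1%N < gamma.
  move: dom1 (N1P K.+1 (leqW N1K)) => []; rewrite /phi add1n.
  rewrite -(fineK (fx_fin K)) -(fineK fbar_fin) -EFinB !lee_fin !lte_fin /= => ge0 lt_eta lt_dxi.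
  by apply: dxiP => //; lra.
pose B := (l1 * e K + l2 * phi 1%N + l3 * (C * s K)) / (1 - l1).
exists K, B; split=> //.
apply: (trapping tau l1 l2 l3 c C eps delta (fun k => enorm (x (k + K)%N - xbar))
  (fun k => e (k + K)%N) phi (fun k => s (k + K)%N)) => //=.
- exact: ltW.
- move=> n; rewrite addSnnS (eq_bigr (fun k : 'I_n => e (k + K.+1)%N)) => [|k _].
    exact: path_length_le.
  by rewrite addSnnS.
- move=> k k_lt.
  have [] := Hineq (k + K).+1 (leqW (leq_trans k1K (leq_addl _ _))) (lt_le_trans k_lt eps_le).
  by move=> si [domk domk1 ek]; split=> //; exact: xi_ge0.
- have B_le : B <= A * gamma.
    rewrite /B /A mulrAC ler_wpM2r ?invr_ge0 ?subr_ge0 ?(ltW l1_lt1) //.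
    rewrite !mulrDl -mulrA.
    by rewrite !lerD // ler_wpM2l // ?ler_wpM2l // ltW.
  have -> : eps = gamma + c * (A * gamma).
    by rewrite mulrA -{1}(mul1r gamma) -mulrDl /gamma mulrC divfK // gt_eqF.
  by rewrite ltr_leD // ler_wpM2l // ltW.
Qed.

Theorem theorem4p3 (R : realType) (m : nat) (f : 'rV[R]_m -> \bar R)
  (f_proper : proper_fun f)
  (f_lsc : lower_semicontinuous f)
  (f_bdd : bounded_below f)
  (eta : R) (eta_gt0 : 0 < eta)
  (xi : R -> R) (xi_modulus : modulus eta xi)
  (s : nat -> R) (s_ge0 : forall k, 0 <= s k) (s_cvg0 : s @ \oo --> (0 : R))
  (x : nat -> 'rV[R]_m) (e : nat -> R) (e_ge0 : forall k, 0 <= e k)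
  (H0 : condH0 f x) (H1 : condH1 x e) (H2 : condH2 f x e) (H3 : condH3 f x)
  (k0 : nat) (level_bdd : bounded_set [set y | (f y <= f (x k0))%E])
  (xbar : 'rV[R]_m) (Xi : set 'rV[R]_m) (Xi_closed : closed Xi)
  (xbar_acc : cluster (x @ \oo) xbar)
  (acc_sub : cluster (x @ \oo) `<=` Xi)
  (Xi_sub : Xi `<=` [set y | subdiff f y 0])
  (tau : R -> R) (tau_nd : nondecreasing_on_nonneg tau)
  (tau_shrink : asymptotically_shrinking tau)
  (l1 l2 l3 : R) (l1_ge0 : 0 <= l1) (l1_lt1 : l1 < 1)
  (l2_ge0 : 0 <= l2) (l3_ge0 : 0 <= l3)
  (k1 : nat) (k1_gt0 : (0 < k1)%N)
  (Hineq : forall k, (k1 <= k)%N -> enorm (x k - xbar) < eta ->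
     ineq_i s tau k /\ ineq_ii f eta xi xbar x e s l1 l2 l3 k) :
  [/\ exists2 k2, (k1 <= k2)%N &
        forall k, (k2 < k)%N ->
          [/\ enorm (x k - xbar) < eta, ineq_i s tau k &
              ineq_ii f eta xi xbar x e s l1 l2 l3 k],
      (\sum_(0 <= k <oo) (e k)%:E < +oo)%E,
      (\sum_(1 <= k <oo) (enorm (x k.+1 - x k))%:E < +oo)%E,
      x @ \oo --> xbar &
      Xi xbar].
Proof.
have xbar_Xi : Xi xbar by exact: acc_sub.
have fbar_fin : f xbar \is a fin_num by case: (Xi_sub _ xbar_Xi).
have fx_fin k : f (x k.+1) \is a fin_num.
  by have [b [beta [_ _ wP]]] := H2; have [w [? _] _] := wP k.
have [[c c_gt0 step] e_cvg0] := H1.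
have trapped := tail_trapped f eta xi x e s xbar tau l1 l2 l3 c k1
  eta_gt0 xi_modulus s_ge0 s_cvg0 e_ge0 e_cvg0 H0 H3 c_gt0 step xbar_acc
  fbar_fin fx_fin tau_nd tau_shrink l1_ge0 l1_lt1 l2_ge0 l3_ge0 Hineq.
have [K [M [k1K KP]]] := trapped eta eta_gt0 (lexx _).
have e_sum_le n : \sum_(k < n) e k <= \sum_(k < K.+1) e k + M.
  apply: (@le_trans _ _ (\sum_(k < K.+1 + n) e k)).
    rewrite addnC big_split_ord /= lerDl.
    by apply: sumr_ge0.
  rewrite big_split_ord /= lerD2l; apply: le_trans (KP n).2.
  by apply: ler_sum => k _; rewrite addSn addnC.
split=> //.
- exists K => // k Kk.
  have k_near : enorm (x k - xbar) < eta.
    by rewrite -(subnK Kk) addnS -addSn; exact: (KP _).1.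
  have [] := Hineq k (leq_trans k1K (ltnW Kk)) k_near; by split.
- by apply: (nneseries_lty e 0 _ e_ge0) => n; exact: e_sum_le.
- apply: (nneseries_lty (fun k => enorm (x k.+1 - x k)) 1
    (c * (\sum_(k < K.+1) e k + M))) => [k|n]; first exact: enorm_ge0.
  apply: (@le_trans _ _ (c * \sum_(k < n.+1) e k)); last by rewrite ler_pM2l.
  rewrite big_ord_recl mulrDr mulr_sumr -[leLHS]add0r lerD //.
    by rewrite mulr_ge0 // ltW.
  by apply: ler_sum => i _; exact: step.
- apply: cvg_enorm => eps eps_gt0.
  have min_gt0 : 0 < Num.min eps eta by rewrite lt_min eps_gt0.
  have min_le : Num.min eps eta <= eta by rewrite ge_min lexx orbT.
  have [L [ML [_ LP]]] := trapped _ min_gt0 min_le.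
  exists L.+1 => n Ln; rewrite -(subnK Ln) addnS -addSn.
  by have := (LP (n - L.+1)%N).1; rewrite lt_min => /andP[].
Qed.
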